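(* The maximum number of equiangular lines in $\mathbb{R}^{14}$ is at most $29$. The maximum number of equiangular lines in $\mathbb{R}^{16}$ is at most $41$.
   Context: A set of $n$ (distinct) lines through the origin in Euclidean space $\mathbb{R}^d$, represented by unit vectors $v_1,\dots,v_n$, is called equiangular if there is a constant $\alpha\geq 0$ such that $\langle v_i,v_j\rangle=\pm\alpha$ for all $1\leq i<j\leq n$. *)

(* Defs.v *)
From HB Require Import structures.
From mathcomp Require Import all_boot all_order all_algebra.
From mathcomp Require Import reals.

Set Implicit Arguments.
Unset Strict Implicit.
Unset Printing Implicit Defensive.

Import Order.TTheory GRing.Theory Num.Theory.
Local Open Scope ring_scope.

(* The library's [dotmx] is only available over complex-like fields. *)
Definition inner (R : realType) (d : nat) (u v : 'rV[R]_d) : R :=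
  \sum_(k < d) u 0 k * v 0 k.

(* [n] distinct lines [L i]; a line through the origin is the span of a unit
   vector [v i]. The choice of [v i] among the two unit vectors of [L i] only
   affects the signs of the inner products. *)
Definition equiangular (R : realType) (d n : nat)
    (L : 'I_n -> {vspace 'rV[R]_d}) : Prop :=
  injective L /\
  exists v : 'I_n -> 'rV[R]_d,
    (forall i, inner (v i) (v i) = 1 /\ L i = <[v i]>%VS) /\
    exists alpha : R, 0 <= alpha /\
      forall i j : 'I_n, (i < j)%N ->
        inner (v i) (v j) = alpha \/ inner (v i) (v j) = - alpha.

Definition has_equiangular_lines (R : realType) (d n : nat) : Prop :=
  exists L : 'I_n -> {vspace 'rV[R]_d}, equiangular L.

Definition max_equiangular_lines (R : realType) (d N : nat) : Prop :=
  has_equiangular_lines R d N /\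
  forall n : nat, has_equiangular_lines R d n -> (n <= N)%N.

(* Main.v *)
Require Import Defs.
From mathcomp Require Import all_boot all_order all_algebra.
From mathcomp Require Import reals.
From mathcomp Require Import boolp spectral sesquilinear complex.
From mathcomp Require Import zify ring lra.

(** Thirty equiangular lines in dimension 14, or forty-two in dimension 16,
    cannot exist. Let [al] be the common absolute inner product, [n] the number
    of lines, [d] the dimension; the Gram matrix is [1 + al * S], where [S] is a
    Seidel matrix (symmetric, zero diagonal, entries [1] and [-1] elsewhere), and
    it has rank at most [d].

    The angle takes only two values. As [n > 2 * d], the number [- 1 / al] is an
    eigenvalue of the integral matrix [S] of multiplicity more than [n / 2]; its
    minimal polynomial, raised to this multiplicity, divides the characteristic
    polynomial, so that the eigenvalue is rational, and reduction modulo primes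
    shows that it is an odd integer ([seidel_eigenvalue]). The relative bound
    [n <= d * (1 + (n - 1) * al ^ 2)] then leaves [al = 1 / 3] and [al = 1 / 5]
    ([angle_third_or_fifth]).

    If [al = 1 / 3], the argument of Lemmens and Seidel applies. Either all the
    vectors can be signed so as to have positive inner products, and then they
    are independent, or three of them have inner products [- 1 / 3]. Projecting
    the other ones on the orthogonal complement of these three gives vectors that
    fall into three classes; in one class they are pairwise orthogonal or
    opposite, and across classes they span lines at 60 degrees. This bounds
    the number of lines by [28] or by [2 * d - 2] ([lemmens_seidel_third]).

    If [al = 1 / 5], the spectrum of [S] is determined. Let [c] be [6] or [8]
    according as [d] is [14] or [16]. There are at most [d] eigenvalues [x] other
    than [-5]. By the traces of [S] and of its square, their [(x - c) ^ 2] have a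
    sum at most the number of terms, whereas the product of the [x - c] is a
    nonzero integer, since [S - c] is invertible modulo 2. By the inequality
    between the arithmetic and geometric means, all these eigenvalues are [c - 1]
    or [c + 1] ([int_mx_cubic], [fifth_cubic]). Hence a quadratic polynomial [M]
    in [S] is a multiple of the projection on the eigenspace of [c + 1]. The
    diagonal of [M * M] gives the sum of the squares in each row of [M], and
    modulo 4 the entries of [S * S] depend only on the row sums of [S]. Comparing
    the two modulo 16 gives a contradiction ([no_seidel30], [no_seidel42]). *)

Set Implicit Arguments.
Unset Strict Implicit.
Unset Printing Implicit Defensive.

Import Order.TTheory GRing.Theory Num.Theory.
Local Open Scope ring_scope.

(** * Inner products and the frame inequality *)

Section Inner.
Variables (R : realType) (d : nat).
Implicit Types u v w : 'rV[R]_d.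

Lemma innerC u v : inner u v = inner v u.
Proof. by apply: eq_bigr => k _; rewrite mulrC. Qed.

Lemma innerDl u v w : inner (u + v) w = inner u w + inner v w.
Proof. by rewrite -big_split; apply: eq_bigr => k _; rewrite mxE mulrDl. Qed.

Lemma innerZl a u v : inner (a *: u) v = a * inner u v.
Proof. by rewrite /inner mulr_sumr; apply: eq_bigr => k _; rewrite mxE mulrA. Qed.

Lemma innerDr u v w : inner w (u + v) = inner w u + inner w v.
Proof. by rewrite innerC innerDl !(innerC w). Qed.

Lemma innerZr a u v : inner u (a *: v) = a * inner u v.
Proof. by rewrite innerC innerZl innerC. Qed.

Lemma innerNl u v : inner (- u) v = - inner u v.
Proof. by rewrite -scaleN1r innerZl mulN1r. Qed.

Lemma innerNr u v : inner u (- v) = - inner u v.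
Proof. by rewrite innerC innerNl innerC. Qed.

Definition innerE := (innerDl, innerDr, innerNl, innerNr, innerZl, innerZr).

Lemma inner0l v : inner 0 v = 0.
Proof. by rewrite -(scale0r v) innerZl mul0r. Qed.

Lemma inner_suml (I : finType) (P : pred I) (F : I -> 'rV[R]_d) v :
  inner (\sum_(i | P i) F i) v = \sum_(i | P i) inner (F i) v.
Proof.
apply: (big_morph (fun u => inner u v)); last exact: inner0l.
by move=> x y; apply: innerDl.
Qed.

Lemma inner_sumr (I : finType) (P : pred I) (F : I -> 'rV[R]_d) v :
  inner v (\sum_(i | P i) F i) = \sum_(i | P i) inner v (F i).
Proof. by rewrite innerC inner_suml; apply: eq_bigr => i _; rewrite innerC. Qed.

Lemma inner_ge0 u : 0 <= inner u u.
Proof. by apply: sumr_ge0 => k _; rewrite -expr2 sqr_ge0. Qed.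

Lemma inner_eq0 u : inner u u = 0 -> u = 0.
Proof.
move=> u0; apply/rowP => k; rewrite mxE.
have /psumr_eq0P/(_ k isT) := u0.
by move=> H; apply/eqP; rewrite -sqrf_eq0 expr2 H // => i _; rewrite -expr2 sqr_ge0.
Qed.

Lemma sqr_sum_le (I : finType) (x : I -> R) :
  (\sum_i x i) ^+ 2 <= #|I|%:R * \sum_i x i ^+ 2.
Proof.
set s := \sum_i x i; set N : R := #|I|%:R.
have [I0|N0] := posnP #|I|.
  by rewrite /s big1 ?expr0n ?/N ?I0 ?mul0r // => i _; have := fintype0 i I0.
have Np : 0 < N by rewrite ltr0n.
have : 0 <= \sum_i (N * x i - s) ^+ 2 by apply: sumr_ge0 => i _; rewrite sqr_ge0.
rewrite (eq_bigr (fun i => N ^+ 2 * x i ^+ 2 + (- (2 * N * s) * x i + s ^+ 2))).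
  rewrite !big_split /= -!mulr_sumr sumr_const -mulr_natl -/s -/N => H.
  by rewrite -(ler_pM2l Np); lra.
by move=> i _; ring.
Qed.

(** The matrix [W = \sum_i (f i)^T *m f i] has size [d] and the same trace as the
    Gram matrix of [f], and the squares of the two matrices have the same trace.
    Cauchy-Schwarz on the diagonal of [W] gives the claim. Equality holds for an
    orthogonal basis in which each vector is taken with both signs. *)
Lemma frame_bound (I : finType) (f : I -> 'rV[R]_d) :
  (\sum_i inner (f i) (f i)) ^+ 2
    <= d%:R * \sum_i \sum_j inner (f i) (f j) ^+ 2.
Proof.
pose W k l := \sum_i f i 0 k * f i 0 l.
have -> : \sum_i inner (f i) (f i) = \sum_k W k k by rewrite exchange_big.
have -> : \sum_i \sum_j inner (f i) (f j) ^+ 2 = \sum_k \sum_l W k l ^+ 2.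
  transitivity (\sum_i \sum_j \sum_k \sum_l
      (f i 0 k * f j 0 k) * (f i 0 l * f j 0 l)).
    apply: eq_bigr => i _; apply: eq_bigr => j _.
    rewrite expr2 mulr_suml; apply: eq_bigr => k _; exact: mulr_sumr.
  under eq_bigr do rewrite exchange_big /=.
  rewrite exchange_big; apply: eq_bigr => k _ /=.
  under eq_bigr do rewrite exchange_big /=.
  rewrite exchange_big; apply: eq_bigr => l _ /=.
  rewrite expr2 mulr_suml; apply: eq_bigr => i _; rewrite mulr_sumr.
  by apply: eq_bigr => j _; ring.
apply: le_trans (sqr_sum_le _) _; rewrite card_ord ler_wpM2l ?ler0n //.
apply: ler_sum => k _; rewrite (bigD1 k) //= lerDl.
by apply: sumr_ge0 => l _; rewrite sqr_ge0.
Qed.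

End Inner.

(** * Lines at angle arccos(1/3) *)

Section LemmensSeidel.
Variables (R : realType) (d : nat).
Implicit Types u v w : 'rV[R]_d.

(** In this section [r] is one class of projected vectors: they lie on a set of
    pairwise orthogonal lines, each of which carries at most two of them. *)
Section Class.
Variables (I : finType) (r : I -> 'rV[R]_d).
Hypothesis rr : forall x, inner (r x) (r x) = 2 / 3.
Hypothesis rxy : forall x y, x != y ->
  inner (r x) (r y) = 0 \/ inner (r x) (r y) = - (2 / 3).

Lemma class_opposite x y : inner (r x) (r y) = - (2 / 3) -> r y = - r x.
Proof.
move=> xy; suff /eqP : r y + r x = 0 by rewrite addr_eq0 => /eqP.
by apply: inner_eq0; rewrite !innerE !rr (innerC (r y)) xy; lra.
Qed.

(** Two vectors opposite to the same [r x] would be equal, which is excluded by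
    the hypothesis on inner products; so at most one other term is nonzero. *)
Lemma class_row_sum x : \sum_y `|inner (r x) (r y)| <= 4 / 3.
Proof.
rewrite (bigD1 x) //= rr.
have [/existsP[y /andP[yx /eqP xy]]|no] :=
    boolP [exists y, (y != x) && (inner (r x) (r y) == - (2 / 3))].
  rewrite (bigD1 y) //= xy big1 ?addr0 => [|z /andP[zx zy]].
    by rewrite normrN !ger0_norm; lra.
  have [|->|xz] := rxy (x := x) (y := z); rewrite ?normr0 1?eq_sym //.
  have yz : inner (r y) (r z) = 2 / 3.
    by rewrite (class_opposite xy) (class_opposite xz) !innerE rr; lra.
  by have [||] := rxy (x := y) (y := z); rewrite ?yz 1?eq_sym //; lra.
rewrite big1 ?addr0 => [|y yx]; first by rewrite ger0_norm; lra.
have [|->|xy] := rxy (x := x) (y := y); rewrite ?normr0 1?eq_sym //.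
by case/existsP: no; exists y; rewrite yx xy eqxx.
Qed.

Lemma class_inner_sqr x y :
  inner (r x) (r y) ^+ 2 = 2 / 3 * `|inner (r x) (r y)|.
Proof.
have [<-|/rxy[]->] := eqVneq x y.
- by rewrite rr ger0_norm; lra.
- by rewrite normr0 expr0n mulr0.
- by rewrite normrN ger0_norm; lra.
Qed.

(** Bessel's inequality for the orthogonal frame spanned by the class: each line
    of the frame takes a quarter of the squared norm of [y], so there are at most
    four lines, with two vectors each. The sum [w] over the whole class avoids
    choosing a vector on each line. *)
Lemma class_card_bessel y : inner y y = 2 / 3 ->
  (forall x, inner y (r x) ^+ 2 = 1 / 9) -> (#|I| <= 8)%N.
Proof.
move=> yy yr; pose w := \sum_x inner y (r x) *: r x.
have yw : inner y w = #|I|%:R / 9.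
  rewrite inner_sumr (eq_bigr (fun=> 1 / 9)) => [|x _].
    by rewrite sumr_const -(mulr_natl (1 / 9)); lra.
  by rewrite innerZr -expr2.
have abs x : `|inner y (r x)| = 1 / 3.
  have /eqP : `|inner y (r x)| ^+ 2 = (1 / 3) ^+ 2 by rewrite -normrX yr ger0_norm; lra.
  have le13 : (0 : R) <= 1 / 3 by lra.
  by rewrite eqrXn2 ?normr_ge0 // => /eqP.
have ww : inner w w <= #|I|%:R * (4 / 27).
  rewrite inner_suml -sumr_const mulr_suml; apply: ler_sum => x _.
  rewrite innerZl inner_sumr mulr_sumr.
  have /(_ (1 / 9)) := ler_wpM2l _ (class_row_sum x).
  move=> /(_ ltac:(lra)); rewrite mulr_sumr mul1r => H.
  apply: (le_trans _ (le_trans H _)); last by lra.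
  apply: ler_sum => z _; apply: le_trans (ler_norm _) _.
  by rewrite innerZr !normrM !abs; lra.
(* if each line of the frame carries two vectors, then [3 / 4 *: w] is the
   projection of [y] on their span *)
have := inner_ge0 (y - 3 / 4 *: w).
rewrite !innerE yy (innerC w y) yw => H.
have : (#|I|%:R : R) <= 8 by lra.
by rewrite (ler_nat _ _ 8).
Qed.

(** The squared norm [4 / 3] makes each [h i] count in [frame_bound] exactly as
    a pair of opposite vectors [r x], so that three dimensions are removed. *)
Lemma class_card_frame (h : 'I_3 -> 'rV[R]_d) :
  (forall i j, inner (h i) (h j) = (4 / 3) *+ (i == j)) ->
  (forall i x, inner (h i) (r x) = 0) -> (#|I| + 6 <= 2 * d)%N.
Proof.
move=> hh hr.
pose f (s : I + 'I_3) := match s with inl x => r x | inr i => h i end.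
have := frame_bound f; rewrite !big_sumType /=.
under eq_bigr do rewrite rr; under [X in _ + X]eq_bigr do rewrite hh eqxx.
rewrite !sumr_const card_ord.
set S1 := \sum_x _; set S2 := \sum_i _.
have -> : S2 = 16 / 3.
  transitivity (\sum_(i < 3) (16 / 9 : R)); last by rewrite sumr_const card_ord; lra.
  apply: eq_bigr => i _; rewrite big_sumType /= big1 ?add0r => [|x _]; last first.
    by rewrite hr expr0n.
  rewrite (bigD1 i) //= hh eqxx big1 ?addr0 => [|j ji]; first by rewrite mulr1n; lra.
  by rewrite hh eq_sym (negPf ji) expr0n.
have S1le : S1 <= #|I|%:R * (8 / 9).
  rewrite -sumr_const mulr_suml; apply: ler_sum => x _.
  rewrite big_sumType /= [X in _ + X]big1 ?addr0 => [|j _]; last first.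
    by rewrite innerC hr expr0n.
  rewrite (eq_bigr _ (fun y _ => class_inner_sqr x y)) -mulr_sumr.
  by have := class_row_sum x; lra.
rewrite mulr1n -(mulr_natl (2 / 3)) -(mulr_natl (4 / 3)) => H.
have m0 : (0 : R) <= #|I|%:R by rewrite ler0n.
have d0 : (0 : R) <= d%:R by rewrite ler0n.
have := le_trans H (ler_wpM2l d0 (lerD S1le (lexx (16 / 3)))).
move: m0 d0; set m : R := #|I|%:R; set e : R := d%:R => m0 d0 H1.
have : (m + 6) * (m + 6) <= (m + 6) * (2 * e) by lra.
rewrite ler_pM2l; last by lra.
by rewrite /m /e -natrD -natrM ler_nat.
Qed.

End Class.
End LemmensSeidel.

(** The vectors [P i] and [- psum] below are the vertices of a regular
    tetrahedron centered at the origin. *)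
Section Pillar.
Variables (R : realType) (d : nat).
Variable P : 'I_3 -> 'rV[R]_d.
Hypothesis PP : forall i j, inner (P i) (P j) = if i == j then 1 else - (1 / 3).

Definition psum := \sum_i P i.

Lemma inner_psum u : inner u psum = \sum_i inner u (P i).
Proof. exact: inner_sumr. Qed.

Lemma sum3 (F : 'I_3 -> R) i j k : i != j -> i != k -> j != k ->
  \sum_l F l = F i + F j + F k.
Proof.
move=> ij ik jk; rewrite (bigD1 i) //= (bigD1 j) 1?eq_sym //= (bigD1 k) /=; last first.
  by rewrite eq_sym ik eq_sym.
rewrite big1 ?addr0 ?addrA // => l /andP[/andP[li lj] lk].
by move: i j k l ij ik jk li lj lk => [[|[|[|?]]] ?] [[|[|[|?]]] ?] [[|[|[|?]]] ?] [[|[|[|?]]] ?].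
Qed.

Lemma pillar_psum i : inner (P i) psum = 1 / 3.
Proof.
rewrite inner_psum (bigD1 i) //= PP eqxx.
rewrite (eq_bigr (fun=> - (1 / 3))) => [|j ji]; last by rewrite PP eq_sym (negPf ji).
rewrite sumr_const (_ : #|_| = 2); first by lra.
by have := cardC (pred1 i); rewrite card1 card_ord => -[].
Qed.

Lemma psum_psum : inner psum psum = 1.
Proof.
rewrite inner_psum (eq_bigr (fun=> 1 / 3)) => [|i _].
  by rewrite sumr_const card_ord; lra.
by rewrite innerC pillar_psum.
Qed.

(** The three axes of the cube in which the tetrahedron is inscribed; [axis i] is
    the projection on the span of [P] of the unit vectors whose inner product is
    [- 1 / 3] with [P i] and [1 / 3] with the two others. *)
Definition axis i := (1 / 2) *: (psum - P i).

Lemma axis_pillar i j : inner (axis i) (P j) = if i == j then - (1 / 3) else 1 / 3.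
Proof. by rewrite !innerE innerC pillar_psum PP; case: eqP => _; lra. Qed.

Lemma axis_orthogonal i j : inner (axis i) (axis j) = (1 / 3) *+ (i == j).
Proof.
rewrite innerZr innerDr innerNr axis_pillar innerZl innerDl innerNl psum_psum pillar_psum.
by case: eqP => _; rewrite ?mulr1n ?mulr0n; lra.
Qed.

Section Core.
Variables (T : finType) (u : T -> 'rV[R]_d).
Hypothesis uu : forall x, inner (u x) (u x) = 1.
Hypothesis uxy : forall x y, x != y ->
  inner (u x) (u y) = 1 / 3 \/ inner (u x) (u y) = - (1 / 3).
Hypothesis uP : forall x i,
  inner (u x) (P i) = 1 / 3 \/ inner (u x) (P i) = - (1 / 3).
Hypothesis up : forall x, inner (u x) psum = 1 / 3.

(** The three inner products are [1 / 3] up to sign and their sum is [1 / 3]: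
    exactly one of them is negative. *)
Lemma class_exists x :
  exists i, [forall j, inner (u x) (P j) == if i == j then - (1 / 3) else 1 / 3].
Proof.
have H := up x; rewrite inner_psum in H.
have H' i j k (ij : i != j) (ik : i != k) (jk : j != k) := sum3 (fun l => inner (u x) (P l)) ij ik jk.
have [i ui] : exists i, inner (u x) (P i) = - (1 / 3).
  have [|/existsPn no] := boolP [exists i, inner (u x) (P i) == - (1 / 3)].
    by case/existsP => i /eqP; exists i.
  move: H; rewrite (eq_bigr (fun=> 1 / 3)) => [|i _].
    by rewrite sumr_const card_ord; lra.
  by have [//|ui] := uP x i; have := no i; rewrite ui eqxx.
exists i; apply/forallP => j; have [<-|ij] := eqVneq i j; first by rewrite ui.
have [->//|uj] := uP x j.
have [k ik jk] : exists2 k, i != k & j != k.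
  have : (0 < #|~: [set i; j]|)%N by rewrite cardsCs setCK cards2 card_ord ij.
  by case/card_gt0P => k; rewrite !inE negb_or !(eq_sym k) => /andP[]; exists k.
by move: H; rewrite (H' _ _ _ ij ik jk) ui uj; have [|]:= uP x k; lra.
Qed.

Definition cls x := xchoose (class_exists x).

Lemma clsP x j : inner (u x) (P j) = if cls x == j then - (1 / 3) else 1 / 3.
Proof. by have /forallP/(_ j)/eqP := xchooseP (class_exists x). Qed.

Lemma inner_axis x i : inner (u x) (axis i) = (1 / 3) *+ (cls x == i).
Proof.
rewrite innerZr innerDr innerNr up clsP.
by case: eqP => _; rewrite ?mulr1n ?mulr0n; lra.
Qed.

Definition resid x := u x - axis (cls x).

Lemma resid_axis x i : inner (resid x) (axis i) = 0.
Proof. by rewrite innerDl innerNl inner_axis axis_orthogonal subrr. Qed.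

Lemma resid_resid x y :
  inner (resid x) (resid y) = inner (u x) (u y) - (1 / 3) *+ (cls x == cls y).
Proof.
by rewrite [resid y]/resid innerDr innerNr resid_axis subr0 innerDl innerNl
  (innerC (axis _)) inner_axis eq_sym.
Qed.

(** If two classes are inhabited, for each class some vector outside it
    is at 60 or 120 degrees from all its members, so that it contains at most
    eight vectors. Otherwise there is one class, orthogonal to the three axes. *)
Lemma pillar_core : (#|T| <= 24)%N || (#|T| + 6 <= 2 * d)%N.
Proof.
pose I k := {x : T | cls x == k}.
pose r k (s : I k) := resid (val s).
have rr k s : inner (r k s) (r k s) = 2 / 3.
  by rewrite resid_resid uu eqxx mulr1n; lra.
have rxy k s t : s != t -> inner (r k s) (r k t) = 0 \/ inner (r k s) (r k t) = - (2 / 3).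
  move=> st; rewrite resid_resid (eqP (valP s)) (eqP (valP t)) eqxx mulr1n.
  by have [->|->] := uxy (x := val s) (y := val t) st; [left|right]; lra.
have cT : #|T| = (\sum_k #|{: I k}|)%N.
  rewrite -sum1_card (partition_big cls xpredT) //=.
  by apply: eq_bigr => k _; rewrite sum1_card card_sig.
have [/existsP[x /existsP[y cxy]]|] := boolP [exists x, exists y, cls x != cls y].
  suff le8 k : (#|{: I k}| <= 8)%N.
    apply/orP; left; rewrite cT (_ : 24 = \sum_(k < 3) 8)%N ?leq_sum //.
    by rewrite sum_nat_const card_ord.
  have [z ckz] : exists z, cls z != k.
    have [<-|] := eqVneq (cls x) k; last by exists x.
    by exists y; rewrite eq_sym.
  apply: (@class_card_bessel _ _ _ (r k) (rr k) (rxy k) (resid z)).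
    by rewrite resid_resid uu eqxx mulr1n; lra.
  move=> s; rewrite resid_resid (eqP (valP s)) (negPf ckz) subr0.
  have zs : z != val s by apply: contraNneq ckz => ->; rewrite (valP s).
  by have [->|->] := uxy zs; lra.
move=> /existsPn same.
have [T0|] := posnP #|T|; first by rewrite T0.
case/card_gt0P => x _; apply/orP; right.
have -> : #|T| = #|{: I (cls x)}|.
  rewrite card_sig; apply: eq_card => y; rewrite !inE.
  by have /existsPn/(_ x) := same y; rewrite negbK => ->.
apply: (@class_card_frame _ _ _ (r (cls x)) (rr _) (rxy _) (fun i => 2 *: axis i)).
  by move=> i j; rewrite innerZl innerZr axis_orthogonal; case: eqP => _; rewrite ?mulr1n ?mulr0n; lra.
by move=> i s; rewrite innerZl innerC resid_axis mulr0.
Qed.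
End Core.
End Pillar.

Section AngleThird.
Variables (R : realType) (d n : nat) (v : 'I_n -> 'rV[R]_d).
Hypothesis vv : forall i, inner (v i) (v i) = 1.
Hypothesis vij : forall i j, i != j ->
  inner (v i) (v j) = 1 / 3 \/ inner (v i) (v j) = - (1 / 3).

(** The lines split into the three given ones, at most one line through the
    fourth vertex of the tetrahedron, and those counted by [pillar_core], signed
    to have a positive inner product with [psum P]. *)
Lemma pillar_bound (P : 'I_3 -> 'rV[R]_d) (a : 'I_3 -> 'I_n) :
    (forall i j, inner (P i) (P j) = if i == j then 1 else - (1 / 3)) ->
    (forall i, P i = v (a i) \/ P i = - v (a i)) ->
  (n <= 28)%N || (n + 2 <= 2 * d)%N.
Proof.
move=> PP Pv; pose p := psum P.
have vP x i : x \notin codom a ->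
    inner (v x) (P i) = 1 / 3 \/ inner (v x) (P i) = - (1 / 3).
  move=> xa; have xai : x != a i by apply: contraNneq xa => ->; exact: codom_f.
  by have [->|->] := Pv i; rewrite ?innerNr; have [->|->] := vij xai;
    rewrite ?opprK; [left|right|right|left].
(* [B] collects the lines through the fourth vertex of the tetrahedron *)
pose B := [set x | (x \notin codom a) && (inner (v x) p ^+ 2 == 1)].
pose good x := (x \notin codom a) && (inner (v x) p ^+ 2 == 1 / 9).
have sq1 (x : R) : (x ^+ 2 == 1) = (x == 1) || (x == - 1) by rewrite sqrf_eq1.
have sq9 (x : R) : (x ^+ 2 == 1 / 9) = (x == 1 / 3) || (x == - (1 / 3)).
  by rewrite (_ : 1 / 9 = (1 / 3) ^+ 2) ?eqf_sqr //; lra.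
have cover x : (x \in codom a) || (x \in B) || good x.
  rewrite inE /good; case: (boolP (x \in codom a)) => //= xa.
  rewrite sq1 sq9 inner_psum (@sum3 _ _ 0 1 2%:R) //.
  have [->|->] := vP x 0 xa; have [->|->] := vP x 1 xa; have [->|->] := vP x 2%:R xa;
  by apply/orP; (left + right); apply/orP; (left + right); apply/eqP; lra.
have B1 : (#|B| <= 1)%N.
  rewrite leqNgt; apply/negP => /card_gt1P[x [y []]].
  rewrite !inE !sq1 => /andP[_ xp] /andP[_ yp] xy.
  have key z : (inner (v z) p == 1) || (inner (v z) p == - 1) ->
      v z = inner (v z) p *: p.
    move=> zp; apply/eqP; rewrite -subr_eq0; apply/eqP/inner_eq0.
    rewrite !innerE (innerC p) vv psum_psum //.
    by case/orP: zp => /eqP ->; lra.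
  have : inner (v x) (v y) = inner (v x) p * inner (v y) p.
    by rewrite {1}(key x) // innerZl (innerC p).
  by case/orP: xp => /eqP ->; case/orP: yp => /eqP ->; have [->|->] := vij xy; lra.
pose T := {x | good x}.
pose u (s : T) := if inner (v (val s)) p == 1 / 3 then v (val s) else - v (val s).
have cardn : (n <= 3 + 1 + #|{: T}|)%N.
  rewrite card_sig; apply: (@leq_trans #|[set: 'I_n]|); first by rewrite cardsT card_ord.
  have sub : [set: 'I_n] \subset [set x in codom a] :|: B :|: [set x | good x].
    by apply/subsetP => x _; have := cover x; rewrite !inE.
  apply: leq_trans (subset_leq_card sub) _.
  apply: leq_trans (leq_card_setU _ _) _; apply: leq_add; last by rewrite cardsE.
  apply: leq_trans (leq_card_setU _ _) _; apply: leq_add => //.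
  by rewrite cardsE (leq_trans (card_size _)) // size_codom card_ord.
have : (#|{: T}| <= 24)%N || (#|{: T}| + 6 <= 2 * d)%N.
  apply: (@pillar_core _ _ P PP _ u).
  - by move=> s; rewrite /u; case: ifP => _; rewrite ?innerNl ?innerNr ?opprK vv.
  - move=> s t st; have : inner (v (val s)) (v (val t)) = 1 / 3 \/
        inner (v (val s)) (v (val t)) = - (1 / 3) by exact: vij.
    by rewrite /u; case=> H; do 2![case: ifP => _];
      rewrite ?innerNl ?innerNr ?opprK H ?opprK; auto.
  - move=> s i; have /andP[sa _] := valP s.
    by rewrite /u; have [H|H] := vP _ i sa; case: ifP => _;
      rewrite ?innerNl H ?opprK; auto.
  - move=> s; have /andP[_] := valP s; rewrite sq9 /u.
    by case: eqP => //= _ /eqP; rewrite innerNl => ->; rewrite opprK.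
lia.
Qed.

(** The Gram matrix [2 / 3 + 1 / 3 * J], with [J] the all-ones matrix, is
    invertible, with inverse [K = 3 / 2 - s * J] for a suitable [s]. *)
Lemma positive_angle_bound (e : 'I_n -> 'rV[R]_d) :
    (forall i j, inner (e i) (e j) = if i == j then 1 else 1 / 3) ->
  (n <= d)%N.
Proof.
move=> ee; pose s : R := 3 / (2 * (n%:R + 2)).
pose E := \matrix_(i, j) e i 0 j; pose K : 'M[R]_n := (3 / 2)%:M - const_mx s.
apply: (@mulmx1_min _ _ _ E (E^T *m K)); apply/matrixP => i j.
rewrite mulmxA mxE [RHS]mxE.
have -> : \sum_k (E *m E^T) i k * K k j
    = \sum_k (1 / 3 * - s + (1 / 2) *+ (k == j) + (- (2 / 3 * s)) *+ (k == i) + 1 *+ ((k == i) && (i == j))).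
  apply: eq_bigr => k _; rewrite !mxE.
  have -> : \sum_l E i l * E^T l k = if i == k then 1 else 1 / 3.
    by rewrite -ee; apply: eq_bigr => l _; rewrite !mxE.
  by rewrite (eq_sym i k); have [->|_] := eqVneq k i;
    case: eqP => _ /=; rewrite ?mulr1n ?mulr0n; lra.
have one (x : R) (k : 'I_n) : \sum_l x *+ (l == k) = x.
  by rewrite (bigD1 k) //= eqxx big1 ?addr0 // => l /negPf->.
rewrite !big_split /= !one sumr_const card_ord.
under eq_bigr do rewrite -mulnb mulrnA; rewrite sumrMnl one.
rewrite -(mulr_natl (1 / 3 * - s)) /s.
have : (0 : R) <= n%:R by rewrite ler0n.
by move=> n0; field; lra.
Qed.

(** Sign all the vectors to have inner product [1 / 3] with the first one. If two
    of them then have inner product [- 1 / 3], [pillar_bound] applies to these two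
    and the opposite of the first; otherwise all inner products are positive. *)
Lemma lemmens_seidel_third : (n <= 28)%N || (n + 2 <= 2 * d)%N.
Proof.
case: n v vv vij pillar_bound positive_angle_bound => [|m] w ww wij pb ab //.
pose e i := if inner (w ord0) (w i) == - (1 / 3) then - w i else w i.
have ee i : inner (e i) (e i) = 1.
  by rewrite /e; case: ifP => _; rewrite ?innerNl ?innerNr ?opprK ww.
have we i : e i = w i \/ e i = - w i by rewrite /e; case: ifP; auto.
have w0 : e ord0 = w ord0 by rewrite /e ww ifF //; apply/eqP; lra.
have e0 i : i != ord0 -> inner (e ord0) (e i) = 1 / 3.
  rewrite w0 eq_sym => /wij H; rewrite /e; case: eqP => [E|H'].
    by rewrite innerNr E opprK.
  by case: H.
have eij i j : i != j -> inner (e i) (e j) = 1 / 3 \/ inner (e i) (e j) = - (1 / 3).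
  move=> /wij H; have [->|->] := we i; have [->|->] := we j;
    by case: H => H; rewrite ?innerNl ?innerNr ?opprK H ?opprK; auto.
have [/existsP[i /existsP[j /and4P[i0 j0 ij /eqP eijN]]]|no] := boolP
   [exists i, exists j, [&& i != ord0, j != ord0, i != j & inner (e i) (e j) == - (1 / 3)]].
  pose a (k : 'I_3) := [:: ord0; i; j]`_k.
  pose P (k : 'I_3) := [:: - e ord0; e i; e j]`_k.
  apply: (pb P a).
    have ji : inner (e j) (e i) = - (1 / 3) by rewrite innerC.
    move=> [[|[|[|?]]] ?] [[|[|[|?]]] ?] //=; rewrite /P /= ?innerNl ?innerNr ?opprK
      ?ee ?e0 // innerC e0 //.
  move=> [[|[|[|?]]] ?] //; rewrite /P /a /=; auto.
  by rewrite w0; right.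
have : (m.+1 <= d)%N; last by lia.
apply: (ab e) => i j; have [<-|ij] := eqVneq i j; first exact: ee.
have [i0|i0] := eqVneq i ord0; first by rewrite i0 e0 // eq_sym -i0.
have [->|j0] := eqVneq j ord0; first by rewrite innerC e0.
have [//|H] := eij _ _ ij; case/existsP: no; exists i; apply/existsP; exists j.
by rewrite i0 j0 ij H eqxx.
Qed.
End AngleThird.

(** * Diagonalization of symmetric matrices *)

Section Diagonalized.
Variables (F : fieldType) (n : nat) (P : 'M[F]_n).
Hypothesis Pu : P \in unitmx.

Definition conj_diag (X : 'I_n -> F) : 'M[F]_n :=
  invmx P *m diag_mx (\row_i X i) *m P.

Lemma conj_diagM X Y :
  conj_diag X *m conj_diag Y = conj_diag (fun i => X i * Y i).
Proof.
rewrite /conj_diag !mulmxA mulmxK // -[invmx P *m _ *m diag_mx _]mulmxA mulmx_diag.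
congr (_ *m diag_mx _ *m _).
by apply/rowP => i; rewrite !mxE.
Qed.

Lemma conj_diag_subC X a : conj_diag X - a%:M = conj_diag (fun i => X i - a).
Proof.
have -> : a%:M = invmx P *m a%:M *m P by rewrite scalar_mxC -mulmxA mulVmx // mulmx1.
rewrite -mulmxBl -mulmxBr -diag_const_mx -linearB; congr (_ *m diag_mx _ *m _).
by apply/rowP => i; rewrite !mxE.
Qed.

Lemma conj_diag0 X : (forall i, X i = 0) -> conj_diag X = 0.
Proof.
move=> X0; rewrite /conj_diag (_ : \row_i X i = 0).
  by rewrite linear0 mulmx0 mul0mx.
by apply/rowP => i; rewrite !mxE.
Qed.

Lemma trace_conj_diag X : \tr (conj_diag X) = \sum_i X i.
Proof.
rewrite mxtrace_mulC mulmxA mulmxV // mul1mx mxtrace_diag.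
by apply: eq_bigr => i _; rewrite mxE.
Qed.

Lemma rank_conj_diag (X : 'I_n -> F) :
  (#|[pred i | X i != 0%R]| <= \rank (conj_diag X))%N.
Proof.
pose Z := [pred i | X i != 0]; pose f (k : 'I_#|Z|) : 'I_n := enum_val k.
rewrite /conj_diag mxrankMfree ?row_free_unit // eqmxMfull ?row_full_unit ?unitmx_inv //.
apply: (@mulmx1_min_rank _ _ _ _ _
  (\matrix_(k, i) ((X i)^-1 *+ (i == f k))) (\matrix_(i, k) (i == f k)%:R)).
apply/matrixP => k l; rewrite mul_mx_diag !mxE (bigD1 (f k)) //= big1 ?addr0.
  rewrite !mxE eqxx mulr1n mulVf; last exact: (enum_valP k).
  by rewrite mul1r (inj_eq enum_val_inj).
by move=> i /negPf ik; rewrite !mxE ik !mul0r.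
Qed.

Lemma char_poly_conj_diag X : char_poly (conj_diag X) = \prod_i ('X - (X i)%:P).
Proof.
rewrite /char_poly /char_poly_mx /conj_diag !map_mxM.
set Q := map_mx _ P; set Q' := map_mx _ (invmx P).
have QQ : Q' *m Q = 1%:M by rewrite -map_mxM mulVmx // map_mx1.
have -> : 'X%:M = Q' *m 'X%:M *m Q by rewrite scalar_mxC -mulmxA QQ mulmx1.
rewrite -mulmxBl -mulmxBr !det_mulmx mulrAC -det_mulmx QQ det1 mul1r.
rewrite map_diag_mx -diag_const_mx -linearB det_diag.
by apply: eq_bigr => i _; rewrite !mxE.
Qed.

End Diagonalized.

Lemma symmetric_diagonalizable (C : numClosedFieldType) n (A : 'M[C]_n) :
    A^T = A -> (forall i j, A i j \is Num.real) ->
  exists (P : 'M[C]_n) (X : 'I_n -> C),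
    [/\ P \in unitmx, forall i, X i \is Num.real & A = conj_diag P X].
Proof.
move=> At Ar; have Ah : A \is hermsymmx.
  apply: realsym_hermsym; last by apply/mxOverP.
  by apply/is_hermitianmxP; rewrite expr0 scale1r map_mx_id.
exists (spectralmx A), (fun i => spectral_diag A 0 i); split.
- exact: spectral_unit.
- by move=> i; apply: (mxOverP (hermitian_spectral_diag_real Ah)).
have /orthomx_spectralP := hermitian_normalmx Ah; rewrite /conj_diag => {1}->.
by congr (_ *m diag_mx _ *m _); apply/rowP => i; rewrite mxE.
Qed.

(** If the minimal polynomial [q] of [l] over the rationals had degree at least
    two, then [q ^ m] would divide [p] with [m] more than half the degree of [p]. *)
Section RationalRoot.
Variables (C : numFieldType) (l : C).
Local Notation toC := (map_poly (ratr : rat -> C)).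

Lemma rational_of_mup (p : {poly rat}) : p != 0 ->
  (size p <= (mup l (toC p)).*2)%N -> exists q, l = ratr q.
Proof.
move=> p0 sp.
have toC0 (r : {poly rat}) : (toC r == 0) = (r == 0) by exact: map_poly_eq0.
have rt : root (toC p) l.
  have : (0 < mup l (toC p))%N.
    by rewrite lt0n; apply: contraTneq sp => ->; rewrite leqn0 size_poly_eq0.
  by rewrite -XsubC_dvd ?toC0 // dvdp_XsubCl.
have [q [q0 rq qmin]] : exists q : {poly rat}, [/\ q != 0, root (toC q) l &
    forall r, r != 0 -> root (toC r) l -> (size q <= size r)%N].
  have ex : exists k, `[< exists r, [/\ r != 0, root (toC r) l & size r = k] >].
    by exists (size p); apply/asboolP; exists p.
  case: (ex_minnP ex) => k /asboolP[q [q0 rq <-]] qmin.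
  by exists q; split=> // r r0 rr; apply: qmin; apply/asboolP; exists r.
have qdvd r : root (toC r) l -> q %| r.
  move=> rr; rewrite /dvdp; apply: contraTT isT => r1.
  have : root (toC (r %% q)) l.
    move: rr; rewrite {1}(divp_eq r q) rmorphD rmorphM /= rootE hornerD hornerM.
    by move: rq; rewrite !rootE => /eqP->; rewrite mulr0 add0r.
  by move/(qmin _ r1); rewrite leqNgt ltn_modp q0.
have sq1 : (1 < size q)%N.
  rewrite ltnNge; apply: contraL rq => /size1_polyC qE.
  by move: q0; rewrite qE map_polyC rootC polyC_eq0 fmorph_eq0.
(* a double root of [q] would be a root of its derivative *)
have mupq : mup l (toC q) = 1%N.
  apply/eqP; rewrite eqn_leq -XsubC_dvd ?toC0 // dvdp_XsubCl rq andbT.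
  rewrite mup_leq ?toC0 //; apply/negP => /dvdpP[s qE].
  have : root (toC q^`()) l.
    by rewrite -deriv_map qE expr2 mulrA derivM derivXsubC mulr1 rootE !hornerE
       subrr ?mulr0 ?addr0.
  have q'0 : q^`() != 0.
    apply: contraTneq q0 => /(congr1 (fun r : {poly rat} => r`_(size q).-2)).
    rewrite coef_deriv coef0 negbK -lead_coef_eq0 lead_coefE.
    by case: (size q) sq1 => [|[|k]] //= _ /eqP; rewrite mulrn_eq0.
  by move/(qmin _ q'0); rewrite leqNgt lt_size_deriv.
(* each factor [q] of [r] accounts for one unit of the multiplicity of [l] *)
have bound m (r : {poly rat}) : r != 0 -> (m <= mup l (toC r))%N ->
    (m * (size q).-1 < size r)%N.
  elim: m r => [|m IHm] r r0 mr; first by rewrite mul0n size_poly_gt0.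
  have : root (toC r) l by rewrite -dvdp_XsubCl XsubC_dvd ?toC0 // (leq_trans _ mr).
  case/qdvd/dvdpP => s rE; move: r0 mr; rewrite rE mulf_eq0 negb_or => /andP[s0 _].
  rewrite rmorphM mupM ?toC0 //= mupq addn1 ltnS => /(IHm s s0).
  by rewrite size_mul // mulSn -{4}(prednK (ltnW sq1)) addnS /= addnC ltn_add2r.
have := bound _ p p0 (leqnn _) => sp2.
have sq : size q = 2.
  apply/eqP; rewrite eqn_leq sq1 andbT leqNgt; apply/negP => sq3.
  by move: sp2; rewrite ltnNge => /negP[]; apply: leq_trans sp _; rewrite -muln2 leq_mul2l; lia.
exists (- q`_0 / q`_1).
have q1 : q`_1 != 0 by move: q0; rewrite -lead_coef_eq0 lead_coefE sq.
move: rq; rewrite rootE (horner_coef_wide _ (n := 2)) ?size_map_poly ?sq //.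
rewrite !big_ord_recl big_ord0 /= !coef_map expr0 expr1 mulr1 addr0 => /eqP H.
rewrite fmorph_div rmorphN; apply: (mulIf (x := ratr q`_1)); first by rewrite fmorph_eq0.
rewrite divfK ?fmorph_eq0 //; apply/eqP; rewrite -subr_eq0 opprK addrC mulrC; apply/eqP.
exact: H.
Qed.
End RationalRoot.

(** The equality case of the inequality between arithmetic and geometric means:
    the mean is at most [1] and the product at least [1]. *)
Lemma agm_rigid (C : numDomainType) (I : finType) (A : {pred I}) (E : I -> C) :
    {in A, forall i, 0 <= E i} -> \sum_(i in A) E i <= #|A|%:R ->
    1 <= \prod_(i in A) E i ->
  {in A, forall i, E i = 1}.
Proof.
move=> E0 sE pE i iA; set n := #|A| in sE.
have n0 : (0 < n)%N by apply/card_gt0P; exists i.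
have nR : (0 : C) < n%:R by rewrite ltr0n.
have [le eqc] := leif_AGM_scaled (E := E) (A := A) (fun j jA => mulrn_wge0 _ (E0 j jA)).
have pn : \prod_(j in A) (E j *+ #|A|) = n%:R ^+ n * \prod_(j in A) E j.
  by rewrite -/n -prodr_const -big_split; apply: eq_bigr => j _; rewrite /= mulr_natl.
have up : (\sum_(j in A) E j) ^+ n <= n%:R ^+ n.
  by rewrite lerXn2r ?nnegrE ?sumr_ge0 // ltW.
have lo : n%:R ^+ n <= n%:R ^+ n * \prod_(j in A) E j by rewrite ler_peMr // exprn_ge0 // ltW.
have : [forall j in A, forall k in A, E j == E k].
  by rewrite -eqc eq_le le pn (le_trans up lo).
move=> /forall_inP/(_ i iA)/forall_inP all_eq.
have Ei j : j \in A -> E j = E i by move=> jA; rewrite (eqP (all_eq j jA)).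
move: sE pE; rewrite (eq_bigr _ Ei) sumr_const -/n -[E i *+ n]mulr_natl ger_pMr // => le1.
rewrite (eq_bigr _ Ei) prodr_const -/n => ge1.
apply/eqP; rewrite eq_le le1 /=; apply: contraLR ge1 => Nle.
have [real0 real1] : E i \is Num.real /\ 1 \is (@Num.real C).
  by rewrite ger0_real ?E0 // real1.
rewrite -real_ltNge // in Nle.
by rewrite -real_ltNge ?rpredX ?exprn_ilt1 ?E0 // -lt0n.
Qed.

Section Rigid.
Variables (C : numClosedFieldType) (n : nat) (T : 'M[int]_n).
Hypothesis Tt : T^T = T.
Local Notation iC := (intr : int -> C).
Local Notation TC := (map_mx iC T).

Lemma int_mx_diagonalizable :
  exists (P : 'M[C]_n) (X : 'I_n -> C),
    [/\ P \in unitmx, forall i, X i \is Num.real & TC = conj_diag P X].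
Proof.
apply: symmetric_diagonalizable; first by rewrite map_trmx Tt.
by move=> i j; rewrite mxE realz.
Qed.

(** The trace identity says that [\sum (x - c) ^ 2 = d] over [d] eigenvalues [x]
    that include all the nonzero ones. Since [c ^ 2 > 1], discarding the zero
    ones among them leaves a sum at most the number of terms. The product of the
    [c - x] over the nonzero eigenvalues is the value at [c] of a polynomial with integer
    coefficients, the characteristic polynomial stripped of its power of ['X];
    so it is a nonzero integer. Hence [agm_rigid] applies to the [(x - c) ^ 2]. *)
Lemma int_mx_cubic d (c : int) : (\rank TC <= d)%N -> 1 < c ->
    \tr (T *m T) - 2 * c * \tr T + c ^+ 2 * d%:R = d%:R ->
    \det (c%:M - T) != 0 ->
  T *m (T - (c - 1)%:M) *m (T - (c + 1)%:M) = 0.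
Proof.
move=> rk c1 tr det0.
have [P [X [Pu Xr TE]]] := int_mx_diagonalizable.
pose Z := [pred i | X i != 0]; pose E i := (X i - iC c) ^+ 2.
have zd : (#|Z| <= d)%N by apply: leq_trans (rank_conj_diag Pu X) _; rewrite -TE.
have E0 i : 0 <= E i by rewrite real_exprn_even_ge0 // rpredB ?realz.
have sE : \sum_(i in Z) E i <= #|Z|%:R.
  have tot : \sum_i E i = iC (\tr (T *m T) - 2 * c * \tr T + c ^+ 2 * n%:R).
    rewrite (eq_bigr (fun i => X i * X i + (- (2 * iC c) * X i + iC c ^+ 2))); last first.
      by move=> i _; rewrite /E; ring.
    rewrite !big_split /= -mulr_sumr sumr_const card_ord -(trace_conj_diag Pu X).
    rewrite -(trace_conj_diag Pu (fun i => X i * X i)) -conj_diagM // -TE -map_mxM.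
    by rewrite !trace_map_mx; rewrite -mulr_natr; ring.
  have : \sum_i E i = \sum_(i in Z) E i + iC c ^+ 2 * (n%:R - #|Z|%:R).
    rewrite (bigID [in Z]) /=; congr (_ + _).
    rewrite (eq_bigr (fun=> iC c ^+ 2)) => [|i]; last first.
      by rewrite negbK /E => /eqP ->; rewrite sub0r sqrrN.
    rewrite sumr_const -[LHS]mulr_natr; congr (_ * _).
    by apply/eqP; rewrite eq_sym subr_eq -natrD addnC -[n in n%:R]card_ord -(cardC Z).
  rewrite tot => /esym/(canRL (addrK _)) ->.
  have -> : \tr (T *m T) - 2 * c * \tr T + c ^+ 2 * n%:R
      = d%:R + c ^+ 2 * (n%:R - d%:R) by rewrite -{1}tr; ring.
  have -> : iC (d%:R + c ^+ 2 * (n%:R - d%:R)) - iC c ^+ 2 * (n%:R - #|Z|%:R)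
      = #|Z|%:R + (1 - iC c ^+ 2) * (d%:R - #|Z|%:R) by ring.
  rewrite gerDl mulr_le0_ge0 ?subr_ge0 ?ler_nat // subr_le0 exprn_ege1 //.
  by rewrite (ler_int _ 1) ltW.
have pE : 1 <= \prod_(i in Z) E i.
  pose k := #|[predC Z]|; pose Q := \prod_(i in Z) ('X - (X i)%:P).
  have chE : map_poly iC (char_poly T) = Q * 'X^k.
    rewrite map_char_poly TE char_poly_conj_diag // (bigID [in Z]) /=; congr (_ * _).
    rewrite (eq_bigr (fun=> 'X)) ?prodr_const // => i.
    by rewrite negbK => /eqP ->; rewrite subr0.
  have QE : Q = map_poly iC (drop_poly k (char_poly T)).
    rewrite -[LHS](drop_polyMXn_id k) -chE.
    by apply/polyP => i; rewrite !(coef_drop_poly, coef_map).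
  have QcE : Q.[iC c] = iC (drop_poly k (char_poly T)).[c] by rewrite QE horner_map.
  have Qc0 : Q.[iC c] != 0.
    have : iC (char_poly T).[c] != 0.
      rewrite intr_eq0; apply: contra det0 => /eqP; rewrite /char_poly.
      rewrite -horner_evalE -det_map_mx => cT; rewrite -cT; apply/eqP; congr (\det _).
      by apply/matrixP => i j; rewrite !mxE /= /horner_eval !hornerE hornerMn hornerX.
    by rewrite -horner_map chE hornerM mulf_eq0 negb_or => /andP[].
  have -> : \prod_(i in Z) E i = iC ((drop_poly k (char_poly T)).[c] ^+ 2).
    rewrite rmorphXn /= -QcE horner_prod -prodrXl; apply: eq_bigr => i _.
    by rewrite !hornerE /E -sqrrN opprB.
  rewrite (ler_int _ 1) -gtz0_ge1 exprn_even_gt0 //=.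
  by move: Qc0; rewrite QcE intr_eq0.
have XE i : [|| X i == 0, X i == iC (c - 1) | X i == iC (c + 1)].
  have [//|Xi0] := eqVneq (X i) 0.
  have /eqP := agm_rigid (fun i _ => E0 i) sE pE (x := i) Xi0.
  rewrite /E -{2}(expr1n _ 2) eqf_sqr => /orP[|] /eqP/(canRL (subrK _)) ->.
    by rewrite addrC [(c + 1)%:~R]intrD eqxx !orbT.
  by rewrite addrC [(c - 1)%:~R]intrB eqxx.
set W := _ *m _; suff WC : map_mx iC W = 0.
  by apply/matrixP => i j; move/matrixP/(_ i j)/eqP: WC; rewrite !mxE intr_eq0 => /eqP.
rewrite !map_mxM !map_mxB !map_scalar_mx /= TE !conj_diag_subC // !conj_diagM //.
rewrite conj_diag0 // => i.
by case/or3P: (XE i) => /eqP ->; rewrite ?subrr ?mul0r ?mulr0 ?mul0r.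
Qed.
End Rigid.

(** * Seidel matrices and their eigenvalues of large multiplicity *)

Definition seidel n (S : 'M[int]_n) := forall i j : 'I_n,
  [/\ S i j = S j i, S i i = 0 & i != j -> S i j = 1 \/ S i j = -1].

Section Seidel.
Variables (n : nat) (S : 'M[int]_n).
Hypothesis Sd : seidel S.

Lemma seidel_sym : S^T = S.
Proof. by apply/matrixP => i j; rewrite mxE; have [] := Sd j i. Qed.

Lemma seidel_diag i : S i i = 0.
Proof. by have [] := Sd i i. Qed.

Lemma seidel_off i j : i != j -> S i j = 1 \/ S i j = -1.
Proof. by have [] := Sd i j. Qed.

(** Modulo 2 the matrix is [J - 1], with [J] the all-ones matrix, and for even
    size its square is the identity: [J *m J = n%:R *: J]. *)
Lemma seidel_det_neq0 (c : int) : ~~ odd n -> (2 %| c)%Z -> \det (c%:M - S) != 0.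
Proof.
move=> en /dvdzP[c' ->];
have two : (2%:R : 'F_2) = 0 by rewrite pchar_Fp_0.
have opp (x : 'F_2) : - x = x.
  by apply/eqP; rewrite eq_sym -addr_eq0 -mulr2n -mulr_natl two mul0r.
apply: contraTneq isT => det0.
have [B BE] : exists B, B = map_mx (intr : int -> 'F_2) ((c' * 2)%:M - S) by eexists.
have Bij i j : B i j = 1 - (i == j)%:R.
  rewrite BE !mxE intrB rmorphMn /= intrM [2%:~R]two mulr0 mul0rn sub0r opp.
  have [<-|ij] := eqVneq i j; first by rewrite seidel_diag /= subrr.
  by have [->|->] := seidel_off ij; rewrite subr0 // intrN opp.
have BB : B *m B = 1%:M.
  apply/matrixP => i j; rewrite !mxE.
  under eq_bigr do rewrite !Bij mulrBl mul1r mulrBr mulr1.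
  have one (k : 'I_n) (F : 'I_n -> 'F_2) : \sum_l (l == k)%:R * F l = F k.
    by rewrite (bigD1 k) //= eqxx mul1r big1 ?addr0 // => l /negPf->; rewrite mul0r.
  rewrite !sumrB sumr_const card_ord.
  under eq_bigr do rewrite -[_%:R]mulr1; rewrite one.
  under eq_bigr do rewrite eq_sym -[_%:R]mulr1; rewrite one.
  under eq_bigr do rewrite eq_sym; rewrite one.
  have -> : n%:R = 0 :> 'F_2.
    by rewrite -(odd_double_half n) (negPf en) add0n -muln2 natrM two mulr0.
  by rewrite sub0r opp subKr.
have : \det B * \det B = 1 by rewrite -det_mulmx BB det1.
by rewrite BE det_map_mx det0 rmorph0 mul0r => /eqP; rewrite eq_sym oner_eq0.
Qed.

(** Write [q = a / b] in lowest terms; then [b *: S - a%:M] is singular. Modulo a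
    prime divisor of [b] it is the scalar matrix [- a], which is invertible. So
    [b = 1], and [seidel_det_neq0] excludes even values of [a]. *)
Lemma seidel_rational_eigenvalue (F : numFieldType) (q : rat) : ~~ odd n ->
    \det (map_mx (intr : int -> F) S - (ratr q)%:M) = 0 ->
  exists a : int, q = a%:~R /\ ~~ (2 %| a)%Z.
Proof.
move=> en det0; pose a := numq q; pose b := denq q.
have n0 : (0 < n)%N.
  rewrite lt0n; apply: contra_eqN det0 => /eqP nz.
  by move: S; rewrite nz => S'; rewrite det_mx00 oner_eq0.
have b0 : b%:~R != 0 :> F by rewrite intr_eq0 denq_eq0.
have dab : \det (b *: S - a%:M) = 0.
  apply/eqP; rewrite -(intr_eq0 F) -det_map_mx; apply/eqP.
  have -> : map_mx intr (b *: S - a%:M) = b%:~R *: (map_mx (intr : int -> F) S - (ratr q)%:M).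
    apply/matrixP => i j; rewrite !mxE intrB intrM rmorphMn /= mulrBr; congr (_ - _).
    rewrite mulrnAr; congr (_ *+ _).
    by rewrite /ratr mulrC divfK.
  by rewrite detZ det0 mulr0.
have b1 : b = 1.
  have bp : 0 < b := denq_gt0 q.
  have : (`|b|%N <= 1)%N; last by lia.
  rewrite leqNgt; apply/negP => b2; pose p := pdiv `|b|%N.
  have pp : prime p by exact: pdiv_prime.
  have pb : ((p : int) %| b)%Z by rewrite dvdzE /= pdiv_dvd.
  have Fp0 (x : int) : (x%:~R == 0 :> 'F_p) = (p %| `|x|)%N.
    rewrite (dvdn_pcharf (pchar_Fp pp)).
    by case: x => m //=; rewrite NegzE mulrNz oppr_eq0.
  have : (a%:~R == 0 :> 'F_p).
    have : \det (map_mx (intr : int -> 'F_p) (b *: S - a%:M)) == 0.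
      by rewrite det_map_mx dab rmorph0.
    have -> : map_mx (intr : int -> 'F_p) (b *: S - a%:M) = (- a%:~R)%:M.
      apply/matrixP => i j; rewrite !mxE intrB intrM rmorphMn /= mulNrn.
      have /eqP -> : b%:~R == 0 :> 'F_p by rewrite Fp0.
      by rewrite mul0r sub0r.
    by rewrite det_scalar expf_eq0 n0 oppr_eq0.
  rewrite Fp0 => pa; have cop : coprime `|a| `|b| := coprime_num_den q.
  have : (p %| gcdn `|a| `|b|)%N by rewrite dvdn_gcd pa pdiv_dvd.
  by rewrite (eqP cop) dvdn1 => /eqP p1; rewrite p1 in pp.
have qE : q = a%:~R by rewrite -(divq_num_den q) -/a -/b b1 divr1.
exists a; split=> //; apply/negP => a2.
have := seidel_det_neq0 en a2; rewrite -opprB -scaleN1r detZ.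
by move: dab; rewrite b1 scale1r => ->; rewrite mulr0 eqxx.
Qed.

Local Open Scope complex_scope.

(** Over the complex numbers [S] is diagonalizable, so that the rank hypothesis
    makes [l] a root of its characteristic polynomial of multiplicity at least
    [n - d], which is more than half the degree. *)
Lemma seidel_eigenvalue (R : rcfType) (l : R) d : ~~ odd n -> (2 * d < n)%N ->
    (\rank (map_mx (intr : int -> R) S - l%:M)%R <= d)%N ->
  exists a : int, l = a%:~R /\ ~~ (2 %| a)%Z.
Proof.
move=> en dn rk.
have det0 : \det (map_mx (intr : int -> R) S - l%:M) = 0.
  apply/eqP; move: rk; apply: contraLR; rewrite -unitfE -unitmxE => /mxrank_unit ->.
  lia.
suff [q lq] : exists q, l = ratr q.
  by move: det0; rewrite lq => /(seidel_rational_eigenvalue en)[a [-> a2]];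
    exists a; rewrite ratr_int.
pose SC := map_mx (intr : int -> R[i]) S.
have [P [X [Pu _ SE]]] := int_mx_diagonalizable R[i] seidel_sym.
have rkC : (#|[pred i | X i != l%:C]| <= d)%N.
  apply: leq_trans rk; rewrite -(mxrank_map (real_complex R)).
  rewrite map_mxB map_scalar_mx -map_mx_comp.
  have -> : map_mx (real_complex R \o intr) S = conj_diag P X.
    by rewrite -SE; apply: eq_map_mx => x /=; rewrite rmorph_int.
  rewrite conj_diag_subC //; apply: leq_trans (rank_conj_diag Pu _).
  by apply/eq_leq/eq_card => i; rewrite !inE subr_eq0.
pose p := map_poly (intr : int -> rat) (char_poly S).
have pE : map_poly (ratr : rat -> R[i]) p = \prod_i ('X - (X i)%:P).
  rewrite -(char_poly_conj_diag Pu) -SE -map_char_poly -map_poly_comp.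
  by apply: eq_map_poly => x /=; rewrite ratr_int.
have sp : size p = n.+1 by rewrite size_map_inj_poly ?size_char_poly //; exact: intr_inj.
have p0 : p != 0 by rewrite -size_poly_eq0 sp.
have [|q lq] := rational_of_mup (l := l%:C) p0.
  rewrite sp pE -(big_map X xpredT (fun x => 'X - x%:P)) mu_prod_XsubC.
  rewrite count_map -sum1_count /= sum1_card.
  have := cardC [pred i | X i == l%:C]; rewrite card_ord.
  have -> : #|[predC [pred i | X i == l%:C]]| = #|[pred i | X i != l%:C]|.
    by apply: eq_card => i; rewrite !inE.
  move: rkC; set u := #|_|; set v := #|_|; lia.
by exists q; apply: (@complexI R); rewrite lq /= fmorph_rat.
Qed.
End Seidel.

(** * Counting in the two remaining Seidel matrices *)

(** The square of a multiple of 4 vanishes modulo 16, and the square of twice an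
    odd number is 4: the sum of the squares counts the second kind modulo 4. *)
Lemma sum_sqr_mod16 (I : finType) (P Q : pred I) (m : I -> int) :
    (forall k, P k -> (4 %| m k - 2 * (Q k)%:R)%Z) ->
  (16 %| \sum_(k | P k) m k ^+ 2 - 4 * #|[pred k | P k && Q k]|%:R)%Z.
Proof.
move=> H; have -> : #|[pred k | P k && Q k]|%:R = \sum_(k | P k) (Q k)%:R :> int.
  by rewrite -natr_sum -sum1_card big_mkcondr; congr _%:R; apply: eq_bigr => k _; case: (Q k).
rewrite mulr_sumr -sumrB; apply: rpred_sum => k Pk.
have /dvdzP[t mE] := H k Pk.
have -> : m k = t * 4 + 2 * (Q k)%:R by rewrite -mE subrK.
apply/dvdzP; exists (t ^+ 2 + t * (Q k)%:R).
by case: (Q k); rewrite ?mulr1n ?mulr0n; ring.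
Qed.

Section Rows.
Variables (n : nat) (S : 'M[int]_n).
Hypothesis Sd : seidel S.
Hypothesis n2 : (n %% 4 = 2)%N.

Definition rowsum i := \sum_k S i k.
Definition same i j := (4 %| rowsum i - rowsum j)%Z.

Lemma seidel_sqr_diag i : (S *m S) i i = n%:Z - 1.
Proof.
clear n2; rewrite mxE (bigD1 i) //= (seidel_diag Sd) mul0r add0r.
rewrite (eq_bigr (fun=> 1)) => [|k ki]; last first.
  have [-> _ _] := Sd k i; rewrite eq_sym in ki.
  by case: (seidel_off Sd ki) => ->.
rewrite sumr_const; have := cardC1 i; rewrite card_ord => ->.
have := ltn_ord i; lia.
Qed.

Lemma rowsum_odd i : (2 %| rowsum i - 1)%Z.
Proof.
have : (2 %| rowsum i - (n%:Z - 1))%Z.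
  have -> : n%:Z - 1 = \sum_(k | k != i) 1.
    by rewrite sumr_const cardC1 card_ord; have := ltn_ord i; lia.
  rewrite /rowsum (bigD1 i) //= seidel_diag // add0r -sumrB.
  by apply: rpred_sum => k ki; rewrite eq_sym in ki; case: (seidel_off Sd ki) => ->.
lia.
Qed.

Lemma mod4_aux (x b c : int) : (2 %| b - 1)%Z -> (2 %| c - 1)%Z ->
  (4 %| x - b - c + n%:Z)%Z -> (4 %| x - 2 * (~~ (4 %| b - c)%Z)%:R)%Z.
Proof. by case E: (4 %| b - c)%Z; rewrite /= ?mulr0 ?mulr1; lia. Qed.

(** For [x] and [y] equal to [1] or [-1], [(x - 1) * (y - 1)] is a multiple of 4.
    Summing over [k] with [x = S i k] and [y = S j k] expresses the entry of the
    square, modulo 4, by the row sums. *)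
Lemma seidel_sqr_mod4 i j : i != j ->
  (4 %| (S *m S) i j - 2 * (~~ same i j)%:R)%Z.
Proof.
move=> ij.
have key : (4 %| (S *m S) i j - rowsum i - rowsum j + n%:Z)%Z.
  have -> : (S *m S) i j - rowsum i - rowsum j + n%:Z
      = \sum_k (S i k - 1) * (S j k - 1).
    rewrite (eq_bigr (fun k => S i k * S k j - S i k - S j k + 1)); last first.
      by move=> k _; have [-> _ _] := Sd k j; ring.
    by rewrite big_split !sumrB /= sumr_const card_ord mxE /rowsum natz.
  rewrite (bigD1 i) //= (bigD1 j) 1?eq_sym //= !seidel_diag // addrA.
  have [-> _ _] := Sd j i.
  apply: rpredD; first by case: (seidel_off Sd ij) => ->.
  apply: rpred_sum => k /andP[ki kj]; rewrite eq_sym in ki; rewrite eq_sym in kj.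
  by case: (seidel_off Sd ki) => ->; case: (seidel_off Sd kj) => ->.
exact: mod4_aux (rowsum_odd i) (rowsum_odd j) key.
Qed.

(** The row sums are odd, hence take only two values modulo 4. *)
Lemma not_same_trans i j k : ~~ same i j -> ~~ same j k = same i k.
Proof.
have := rowsum_odd i; have := rowsum_odd j; have := rowsum_odd k; rewrite /same.
by move=> *; apply/idP/idP; lia.
Qed.

Lemma card_not_same i j : ~~ same i j ->
  (#|[pred k | ~~ same i k]| + #|[pred k | ~~ same j k]|)%N = n.
Proof.
move=> ij; rewrite -[RHS]card_ord -(cardC [pred k | same i k]) addnC.
congr addn; apply: eq_card => k; rewrite !inE //.
exact: not_same_trans.
Qed.
End Rows.

(** The matrix [M = S * S - 25] satisfies [M * M = 24 * M] and [M * S = 7 * M]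
    and has diagonal 4, so the squares of the other entries of a row sum to
    [24 * 4 - 4 ^ 2 = 80]. The entries that are not multiples of 4 are those
    between different classes of row sums; their number in a row is the size of
    the opposite class, and [sum_sqr_mod16] makes it a multiple of 4. Two classes
    of such sizes cannot add up to 30. With a single class, the absolute value of
    each entry is at most a quarter of its square, so that the diagonal of
    [M * S] is at most [80 / 4], less than [7 * 4]. *)
Lemma no_seidel30 (S : 'M[int]_30) : seidel S ->
  (S + 5%:M) *m (S - 5%:M) *m (S - 7%:M) <> 0.
Proof.
move=> Sd eq0; pose M := S *m S - 25%:M.
have ME : (S + 5%:M) *m (S - 5%:M) = M.
  rewrite mulmxDl !mulmxBr !mul_scalar_mx mul_mx_scalar scale_scalar_mx addrA /M.
  by rewrite subrK.
have MS : M *m S = 7 *: M.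
  by move: eq0; rewrite ME mulmxBr mul_mx_scalar => /eqP; rewrite subr_eq0 => /eqP.
have MM : M *m M = 24 *: M.
  rewrite {2}/M mulmxBr mulmxA MS -scalemxAl MS mul_mx_scalar scalerA -scalerBl.
  by congr (_ *: M).
have Mii i : M i i = 4.
  have := seidel_sqr_diag Sd i; rewrite [M i i]mxE => ->.
  by rewrite !mxE eqxx mulr1n.
have Mt i j : M i j = M j i.
  have : M^T = M by rewrite linearB /= trmx_mul !(seidel_sym Sd) tr_scalar_mx.
  by move/matrixP/(_ j i); rewrite mxE.
have Moff i j : i != j -> M i j = (S *m S) i j.
  by move=> ij; rewrite [M i j]mxE !mxE (negPf ij) subr0.
have sq i : \sum_(k | k != i) M i k ^+ 2 = 80.
  have := congr1 (fun A : 'M_30 => A i i) MM; rewrite mxE [RHS]mxE Mii (bigD1 i) //= Mii.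
  rewrite (eq_bigr (fun k => M i k ^+ 2)) => [|k _]; last by rewrite (Mt k).
  by move/(canRL (addKr _)).
have M4 i k : k != i -> (4 %| M i k - 2 * (~~ same S i k)%:R)%Z.
  by move=> ki; rewrite Moff 1?eq_sym //; apply: seidel_sqr_mod4 => //; rewrite eq_sym.
have m4 i : (4 %| #|[pred k | ~~ same S i k]|)%N.
  have := sum_sqr_mod16 (P := predC1 i) (Q := [pred k | ~~ same S i k]) (M4 i).
  rewrite sq (_ : #|_| = #|[pred k | ~~ same S i k]|); first by lia.
  apply: eq_card => k; rewrite !inE; case: eqP => //= ->.
  by rewrite /same subrr.
have all_same k : same S ord0 k.
  apply: contraT => nk; have := card_not_same Sd erefl nk.
  by have := m4 ord0; have := m4 k; lia.
have := congr1 (fun A : 'M_30 => A ord0 ord0) MS.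
rewrite mxE [RHS]mxE Mii (bigD1 ord0) //= (seidel_diag Sd) mulr0 add0r.
apply/eqP; rewrite lt_eqF //.
rewrite -(@ltr_pM2l _ 4) //; apply: (@le_lt_trans _ _ 80) => //.
rewrite mulr_sumr -(sq ord0); apply: ler_sum => k k0.
have := M4 ord0 k k0; rewrite all_same /= mulr0 subr0 => /dvdzP[t ->].
by case: (seidel_off Sd k0) => ->; nia.
Qed.

(** Here [M = (S + 5) * (S - 7)] satisfies [M * M = 28 * M] and has diagonal 6,
    so the squares of the other entries of a row sum to [28 * 6 - 6 ^ 2 = 132].
    Because of the term [- 2 * S] the entries that are not multiples of 4 are now
    those inside a class, and [sum_sqr_mod16] makes the size of each class
    [2] modulo 4. Two such classes cannot add up to 42; with a single
    class all [41] other entries of a row are nonzero and even, and their squares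
    sum to at least [164]. *)
Lemma no_seidel42 (S : 'M[int]_42) : seidel S ->
  (S + 5%:M) *m (S - 7%:M) *m (S - 9%:M) <> 0.
Proof.
move=> Sd eq0; pose M := S *m S - 2 *: S - 35%:M.
have ME : (S + 5%:M) *m (S - 7%:M) = M.
  rewrite mulmxDl !mulmxBr !mul_scalar_mx mul_mx_scalar scale_scalar_mx /M.
  by apply/matrixP => i j; set W := S *m S; rewrite !mxE; case: eqP => _ /=; lia.
have MS : M *m S = 9 *: M.
  by move: eq0; rewrite ME mulmxBr mul_mx_scalar => /eqP; rewrite subr_eq0 => /eqP.
have MM : M *m M = 28 *: M.
  rewrite {2}/M !mulmxBr mulmxA MS -scalemxAl MS mul_mx_scalar -scalemxAr MS.
  rewrite !scalerA -!scalerBl.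
  by congr (_ *: M).
have Mij i j : M i j = (S *m S) i j - 2 * S i j - 35 *+ (i == j).
  by rewrite /M; set W := S *m S; rewrite !mxE.
have Mii i : M i i = 6.
  by rewrite Mij (seidel_sqr_diag Sd) (seidel_diag Sd) eqxx.
have Mt i j : M i j = M j i.
  have : M^T = M by rewrite !linearB /= trmx_mul linearZ /= !(seidel_sym Sd) tr_scalar_mx.
  by move/matrixP/(_ j i); rewrite mxE.
have Moff i j : i != j -> M i j = (S *m S) i j - 2 * S i j.
  by move=> ij; rewrite Mij (negPf ij) subr0.
have sq i : \sum_(k | k != i) M i k ^+ 2 = 132.
  have := congr1 (fun A : 'M_42 => A i i) MM; rewrite mxE [RHS]mxE Mii (bigD1 i) //= Mii.
  rewrite (eq_bigr (fun k => M i k ^+ 2)) => [|k _]; last by rewrite (Mt k).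
  by move/(canRL (addKr _)).
have M4 i k : k != i -> (4 %| M i k - 2 * (same S i k)%:R)%Z.
  rewrite eq_sym => ik; rewrite Moff //.
  have := seidel_sqr_mod4 Sd erefl ik.
  by case: (same S i k) => /=; rewrite ?mulr0 ?mulr1; case: (seidel_off Sd ik) => ->; lia.
have m2 i : (#|[pred k | same S i k]| %% 4 = 2)%N.
  have := sum_sqr_mod16 (P := predC1 i) (Q := [pred k | same S i k]) (M4 i).
  have -> : #|[pred k | same S i k]|
      = #|[pred k | predC1 i k && [pred k | same S i k] k]|.+1.
    rewrite (cardD1 i) inE (_ : same S i i) ?add1n; last by rewrite /same subrr.
    by congr _.+1; apply: eq_card.
  rewrite sq; set u := #|_|; lia.
have all_same k : same S ord0 k.
  apply: contraT => nk; have := cardC [pred k | same S ord0 k].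
  rewrite card_ord (@eq_card _ [predC _] [pred l | same S k l]).
    by move: (m2 ord0) (m2 k); set u := #|_|; set v := #|_|; lia.
  move=> l; rewrite !inE; have := not_same_trans Sd erefl l nk.
  by case: (same S k l); case: (same S ord0 l).
have : \sum_(k < 42 | k != ord0) (4 : int) <= 132.
  rewrite -(sq ord0); apply: ler_sum => k k0.
  have := M4 ord0 k k0; rewrite all_same mulr1 => /dvdzP[t E].
  have -> : M ord0 k = t * 4 + 2 by rewrite -E subrK.
  nia.
by rewrite sumr_const cardC1 card_ord.
Qed.

(** * From lines to Seidel matrices *)

Lemma trace_seidel_shift n (S : 'M[int]_n) (a : int) : seidel S ->
  \tr (S + a%:M) = a * n%:Z /\
  \tr ((S + a%:M) *m (S + a%:M)) = n%:Z * (n%:Z - 1) + a ^+ 2 * n%:Z.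
Proof.
move=> Sd; have trS : \tr S = 0 by apply: big1 => i _; rewrite seidel_diag.
have trSS : \tr (S *m S) = n%:Z * (n%:Z - 1).
  rewrite /mxtrace (eq_bigr _ (fun i _ => seidel_sqr_diag Sd i)).
  by rewrite sumr_const card_ord -mulr_natl natz.
split; first by rewrite raddfD /= trS mxtrace_scalar add0r -mulr_natr natz.
rewrite mulmxDl !mulmxDr !mul_scalar_mx mul_mx_scalar scale_scalar_mx.
rewrite !raddfD /= !linearZ /= trS trSS mxtrace_scalar !mulr0 !addr0 add0r.
by rewrite -mulr_natr natz.
Qed.

Section Lines.
Variables (R : realType) (d n : nat) (v : 'I_n -> 'rV[R]_d) (al : R).
Hypothesis vv : forall i, inner (v i) (v i) = 1.
Hypothesis al0 : 0 <= al.
Hypothesis vij : forall i j, i != j ->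
  inner (v i) (v j) = al \/ inner (v i) (v j) = - al.

Lemma equiangular_relative_bound :
  n%:R ^+ 2 <= d%:R * (n%:R + n%:R * (n%:R - 1) * al ^+ 2).
Proof.
have := frame_bound v; rewrite (eq_bigr _ (fun i _ => vv i)) sumr_const card_ord.
move=> H; apply: le_trans H _; rewrite ler_wpM2l ?ler0n //.
rewrite (eq_bigr (fun=> 1 + (n%:R - 1) * al ^+ 2)) => [|i _].
  by rewrite sumr_const card_ord -[_ *+ n]mulr_natl mulrDr mulr1 mulrA.
rewrite (bigD1 i) //= vv expr1n; congr (_ + _).
rewrite (eq_bigr (fun=> al ^+ 2)) => [|j ji].
  rewrite sumr_const cardC1 card_ord -[_ *+ _]mulr_natl; congr (_ * _).
  by rewrite -subn1 natrB // (leq_ltn_trans _ (ltn_ord i)).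
by rewrite eq_sym in ji; have [->|->] := vij ji; rewrite ?sqrrN.
Qed.

Definition sign_mx : 'M[int]_n :=
  \matrix_(i, j) if i == j then 0 else if inner (v i) (v j) == al then 1 else -1.

Lemma seidel_sign_mx : seidel sign_mx.
Proof.
move=> i j; rewrite !mxE eqxx innerC [j == i]eq_sym; split=> //.
by move=> /negPf ->; case: ifP; [left | right].
Qed.

Lemma rank_sign_mx : al != 0 ->
  (\rank (map_mx (intr : int -> R) sign_mx - (- al^-1)%:M)%R <= d)%N.
Proof.
move=> an0; pose V := \matrix_(i, k) v i 0 k.
have -> : map_mx intr sign_mx - (- al^-1)%:M = (al^-1 *: V) *m V^T.
  apply/matrixP => i j; rewrite -scalemxAl !mxE mulNrn opprK.
  have -> : \sum_k V i k * V^T k j = inner (v i) (v j).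
    by apply: eq_bigr => k _; rewrite !mxE.
  have [->|ij] := eqVneq i j; first by rewrite vv mulr1n mulr1 add0r.
  rewrite mulr0n addr0; case: eqP => [->|ne]; first by rewrite mulVf.
  by have [//|->] := vij ij; rewrite mulrN mulVf.
exact: mulmx_max_rank.
Qed.

Local Open Scope complex_scope.

Lemma rank_sign_mx_complex (a : int) : al != 0 -> - al^-1 = - a%:~R ->
  (\rank (map_mx (intr : int -> R[i]) (sign_mx + a%:M)) <= d)%N.
Proof.
move=> an0 aE; have := rank_sign_mx an0; rewrite aE.
rewrite -(mxrank_map (real_complex R)); apply: leq_trans; apply: eq_leq; congr (\rank _).
apply/matrixP => i j; rewrite !mxE mulNrn opprK -rmorphMn -intrD.
by rewrite rmorph_int.
Qed.

(** The numerical hypothesis is the failure of the relative bound for [1 / 6]: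
    the odd integer [1 / al] is larger than [1] and smaller than [6]. *)
Lemma angle_third_or_fifth : (2 * d < n)%N -> ~~ odd n -> al < 1 ->
    (n%:R - d%:R) * 36 > d%:R * (n%:R - 1) :> R ->
  al = 1 / 3 \/ al = 1 / 5.
Proof.
move=> dn en al1 bnd.
have RB := equiangular_relative_bound.
have n0 : (0 : R) < n%:R by rewrite ltr0n; lia.
have d0 : (0 : R) <= d%:R by rewrite ler0n.
have dnR : d%:R < n%:R :> R by rewrite ltr_nat; lia.
have RB' : n%:R - d%:R <= d%:R * (n%:R - 1) * al ^+ 2.
  rewrite -(ler_pM2l n0); move: RB; lra.
have alp : 0 < al.
  rewrite lt_def al0 andbT; apply: contraTneq RB' => ->.
  by rewrite expr0n mulr0 -ltNge subr_gt0.
have := rank_sign_mx (lt0r_neq0 alp) => /(seidel_eigenvalue seidel_sign_mx en dn).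
move=> [a [aE a2]].
pose b := - a; have bE : al^-1 = b%:~R by rewrite /b intrN -aE opprK.
have alE : al = (b%:~R)^-1 by rewrite -bE invrK.
have b1 : 1 < b by rewrite -(ltr_int R) -bE invf_gt1.
have b6 : b < 6.
  rewrite ltNge; apply/negP => b6.
  have b6R : 6 <= b%:~R :> R by rewrite (ler_int _ 6).
  have : al ^+ 2 <= 1 / 36.
    have : al <= 6^-1 by rewrite alE lef_pV2 // posrE; lra.
    move=> H; have := ler_pM al0 al0 H H; rewrite expr2; lra.
  move=> H.
  have n1 : (1 : R) <= n%:R by rewrite ler1n (leq_ltn_trans _ dn).
  have dn1 : 0 <= d%:R * (n%:R - 1) :> R by rewrite mulr_ge0 ?subr_ge0.
  have := ler_wpM2l dn1 H; lra.
have : (b == 3) || (b == 5) by move: a2 b1 b6; rewrite /b; clear; lia.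
by rewrite alE => /orP[] /eqP ->; rewrite !div1r; [left | right].
Qed.

(** [int_mx_cubic] for [S + 5], which has rank at most [d], centered at [c + 5]. *)
Lemma fifth_cubic (c : int) : al = 1 / 5 -> ~~ odd n -> (2 %| c)%Z ->
    1 < c + 5 ->
    n%:Z * (n%:Z - 1) + 25 * n%:Z - 2 * (c + 5) * (5 * n%:Z)
      + (c + 5) ^+ 2 * d%:Z = d%:Z ->
  (sign_mx + 5%:M) *m (sign_mx - (c - 1)%:M) *m (sign_mx - (c + 1)%:M) = 0.
Proof.
move=> a5 en c2 c5 trE; have Sd := seidel_sign_mx.
have sh (x : int) : sign_mx - x%:M = sign_mx + 5%:M - (x + 5)%:M.
  by rewrite [(x + 5)%:M]raddfD /= [x%:M + _]addrC opprD addrA addrK.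
rewrite (sh (c - 1)) (sh (c + 1)) (addrAC c _ 5) (addrAC c 1).
have [tr1 tr2] := trace_seidel_shift 5 Sd.
apply: (@int_mx_cubic R[i] _ _ _ d) => //.
- by rewrite linearD /= seidel_sym // tr_scalar_mx.
- by apply: rank_sign_mx_complex; rewrite a5 div1r ?invr_eq0 ?pnatr_eq0 ?invrK.
- by rewrite tr1 tr2 (natz d).
by rewrite [(c + 5)%:M]raddfD /= opprD addrACA subrr addr0; apply: seidel_det_neq0.
Qed.

End Lines.

Lemma no_lines30 (R : realType) (v : 'I_30 -> 'rV[R]_14) (al : R) :
  (forall i, inner (v i) (v i) = 1) -> 0 <= al -> al < 1 ->
  (forall i j, i != j -> inner (v i) (v j) = al \/ inner (v i) (v j) = - al) ->
  False.
Proof.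
move=> vv al0 al1 vij.
have [||||a|a] := angle_third_or_fifth vv al0 vij => //; first by lra.
  by rewrite a in vij; have := lemmens_seidel_third vv vij.
(* [6] is the integer nearest to the mean of the eigenvalues other than [-5] *)
by apply: (no_seidel30 (seidel_sign_mx v al)); apply: (fifth_cubic vv vij (c := 6)).
Qed.

Lemma no_lines42 (R : realType) (v : 'I_42 -> 'rV[R]_16) (al : R) :
  (forall i, inner (v i) (v i) = 1) -> 0 <= al -> al < 1 ->
  (forall i j, i != j -> inner (v i) (v j) = al \/ inner (v i) (v j) = - al) ->
  False.
Proof.
move=> vv al0 al1 vij.
have [||||a|a] := angle_third_or_fifth vv al0 vij => //; first by lra.
  by rewrite a in vij; have := lemmens_seidel_third vv vij.
by apply: (no_seidel42 (seidel_sign_mx v al)); apply: (fifth_cubic vv vij (c := 8)).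
Qed.

Lemma equiangular_sub (R : realType) d m n :
  (m <= n)%N -> has_equiangular_lines R d n -> has_equiangular_lines R d m.
Proof.
move=> mn [L [Linj [v [Lv [al [al0 vij]]]]]].
exists (L \o widen_ord mn); split; first by move=> i j /Linj /(congr1 val) /= /val_inj.
exists (v \o widen_ord mn); split; first by move=> i; apply: Lv.
by exists al; split=> // i j ij; apply: vij.
Qed.

(** Distinct lines exclude [al = 1]: two unit vectors whose inner product is at
    least [1] in absolute value are equal or opposite. *)
Lemma equiangular_vectors (R : realType) d n : (1 < n)%N ->
    has_equiangular_lines R d n ->
  exists (v : 'I_n -> 'rV[R]_d) (al : R), [/\ forall i, inner (v i) (v i) = 1,
    0 <= al, al < 1 & forall i j, i != j ->
      inner (v i) (v j) = al \/ inner (v i) (v j) = - al].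
Proof.
move=> n1 [L [Linj [v [Lv [al [al0 vlt]]]]]].
have vij i j : i != j -> inner (v i) (v j) = al \/ inner (v i) (v j) = - al.
  by case: (ltngtP i j) => [/vlt//|/vlt|/val_inj ->]; rewrite ?eqxx // innerC.
exists v, al; split=> //; first by move=> i; case: (Lv i).
pose i := Ordinal (ltnW n1); pose j := Ordinal n1.
have ij : i != j by [].
rewrite ltNge; apply/negP => al1.
have [[vi Li] [vj Lj]] := (Lv i, Lv j).
have key (s : R) : s * s = 1 -> inner (v i) (v j) = s * al -> False.
  move=> ss sE.
  have E : v i - s *: v j = 0.
    apply: inner_eq0; apply/eqP; rewrite eq_le inner_ge0 andbT.
    rewrite !innerE (innerC (v j)) vi vj sE; move: ss; nra.
  move/eqP: ij; apply; apply: Linj; rewrite Li Lj.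
  have -> : v i = s *: v j by apply/eqP; rewrite -subr_eq0 E.
  apply/eqP; rewrite eqEsubv -!memvE memvZ ?memv_line //=.
  by rewrite -{1}(scale1r (v j)) -ss -scalerA memvZ ?memv_line.
have [E|E] := vij i j ij.
- by apply: (key 1); rewrite ?mul1r.
- by apply: (key (-1)); rewrite ?mulN1r ?opprK.
Qed.

Lemma max_equiangular_lines_le (R : realType) d B :
    ~ has_equiangular_lines R d B.+1 ->
  exists N, max_equiangular_lines R d N /\ (N <= B)%N.
Proof.
move=> noB; pose P n := `[< has_equiangular_lines R d n >].
have P0 : P 0.
  apply/asboolP; exists (fun=> 0%VS); split; first by case.
  by exists (fun=> 0); split; [case | exists 0; split=> // -[]].
have PB n : P n -> (n <= B)%N.
  move/asboolP => Pn; rewrite leqNgt; apply/negP => Bn.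
  exact: noB (equiangular_sub Bn Pn).
have [N /asboolP PN maxN] := ex_maxnP (ex_intro _ 0%N P0) PB.
by exists N; split; [split=> // n Pn; apply/maxN/asboolP | apply/PB/asboolP].
Qed.

Theorem corollary5p27 (R : realType) :
  (exists N : nat, max_equiangular_lines R 14 N /\ (N <= 29)%N) /\
  (exists N : nat, max_equiangular_lines R 16 N /\ (N <= 41)%N).
Proof.
split; apply: max_equiangular_lines_le => /equiangular_vectors[//|v [al [vv al0 al1 vij]]].
- exact: no_lines30 vv al0 al1 vij.
- exact: no_lines42 vv al0 al1 vij.
Qed.
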